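(* Let $H$ be a finite dimensional Hopf algebra such that $H$ is semisimple and $H^*$ is unimodular, and let $\mathcal{A}$ be an $H$-bimodule algebra. Then: (i) if $V$ is a left $\mathcal{A}\natural H$-module and $W\subseteq V$ is an $\mathcal{A}\natural H$-submodule which has a complement in $V$ as left $\mathcal{A}$-modules, then $W$ has a complement in $V$ as left $\mathcal{A}\natural H$-modules; (ii) if $\mathcal{A}$ is semisimple Artinian, then so is $\mathcal{A}\natural H$.
   Context: Work over a field $k$; $H$ an ordinary Hopf algebra, $\Delta(h)=h_1\otimes h_2$. An $H$-bimodule algebra is an associative unital algebra $\mathcal{A}$ which is an $H$-bimodule (actions $h\cdot\varphi$, $\varphi\cdot h$) with $h\cdot(\varphi\psi)=(h_1\cdot\varphi)(h_2\cdot\psi)$, $(\varphi\psi)\cdot h=(\varphi\cdot h_1)(\psi\cdot h_2)$, $h\cdot1=1\cdot h=\varepsilon(h)1$. The L-R-smash product $\mathcal{A}\natural H$ is $\mathcal{A}\otimes H$ with product $(\varphi\natural h)(\psi\natural h')=(\varphi\cdot h'_2)(h_1\cdot\psi)\natural h_2h'_1$ and unit $1\natural1$; an $\mathcal{A}\natural H$-module is an $\mathcal{A}$-module via the algebra map $\varphi\mapsto\varphi\natural1$. $H^*$ unimodular means its spaces of left and right integrals coincide (equivalently the distinguished group-like element of $H$ is $1$). *)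

(* Defs.v *)
From HB Require Import structures.
From mathcomp Require Import all_boot all_order all_algebra all_field.
Set Implicit Arguments. Unset Strict Implicit. Unset Printing Implicit Defensive.
Import Order.TTheory GRing.Theory Num.Theory.
Local Open Scope ring_scope.

(* Finite dimensional Hopf algebras, presented in coordinates w.r.t. the     *)
(* canonical basis [vbasis {:H}] of the finite dimensional algebra H.        *)
(* An element of H (x) H is a matrix 'M[k]_n of coordinates, so that         *)
(* t = \sum_(i,j) t i j *: (b i (x) b j).                                    *)

Section Hopf.
Variables (k : fieldType) (H : falgType k).

Definition hdim : nat := \dim (fullv : {vspace H}).
Definition hb (i : 'I_hdim) : H := tnth (vbasis (fullv : {vspace H})) i.
Definition hcoord (i : 'I_hdim) (x : H) : k := coord (vbasis (fullv : {vspace H})) i x.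

Definition tens2 (x y : H) : 'M[k]_hdim := \matrix_(i, j) (hcoord i x * hcoord j y).
Definition tens3 (x y z : H) : {ffun 'I_hdim * 'I_hdim * 'I_hdim -> k^o} :=
  [ffun ijl => hcoord ijl.1.1 x * hcoord ijl.1.2 y * hcoord ijl.2 z].

Record hopf_data := HopfData {
  hdelta : H -> 'M[k]_hdim;
  heps : H -> k;
  hS : H -> H
}.

Variable D : hopf_data.

(* Sweedler sum:  sw h F = \sum F (h_1) (h_2)  (F bilinear) *)
Definition sw (X : lmodType k) (h : H) (F : H -> H -> X) : X :=
  \sum_(i < hdim) \sum_(j < hdim) hdelta D h i j *: F (hb i) (hb j).

Definition is_hopf : Prop :=
      (forall (a : k) (x y : H), hdelta D (a *: x + y) = a *: hdelta D x + hdelta D y) /\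
      (forall (a : k) (x y : H), heps D (a *: x + y) = a * heps D x + heps D y) /\
      (forall (a : k) (x y : H), hS D (a *: x + y) = a *: hS D x + hS D y) /\
      (forall h : H, sw h (fun x y => sw x (fun a c => tens3 a c y))
                   = sw h (fun x y => sw y (fun a c => tens3 x a c))) /\
      (forall h : H, sw h (fun x y => heps D x *: y) = h /\
                     sw h (fun x y => heps D y *: x) = h) /\
      ((forall x y : H, hdelta D (x * y)
          = sw x (fun a c => sw y (fun a' c' => tens2 (a * a') (c * c'))))
       /\ hdelta D 1 = tens2 1 1) /\
      ((forall x y : H, heps D (x * y) = heps D x * heps D y) /\ heps D 1 = 1) /\
      (forall h : H, sw h (fun x y => hS D x * y) = heps D h *: 1 /\
                     sw h (fun x y => x * hS D y) = heps D h *: 1).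

(* H^* : linear forms on H, with convolution product; its unit is eps and    *)
(* its counit is evaluation at 1_H.                                          *)
Definition lform (f : H -> k) : Prop :=
  forall (a : k) (x y : H), f (a *: x + y) = a * f x + f y.

Definition left_integral_dual (l : H -> k) : Prop :=
  lform l /\ forall f : H -> k, lform f ->
    forall h : H, sw (X := k^o) h (fun x y => (f x * l y : k^o)) = f 1 * l h.

Definition right_integral_dual (l : H -> k) : Prop :=
  lform l /\ forall f : H -> k, lform f ->
    forall h : H, sw (X := k^o) h (fun x y => (l x * f y : k^o)) = f 1 * l h.

Definition dual_unimodular : Prop :=
  forall l : H -> k, left_integral_dual l <-> right_integral_dual l.

End Hopf.

(* Semisimple (Artinian) rings: a ring given by its additive group T and a  *)
(* multiplication is semisimple iff it is semisimple as a left module over  *)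
(* itself, i.e. every left ideal is a direct summand.                        *)

Definition left_ideal (T : zmodType) (mul : T -> T -> T) (I : T -> Prop) : Prop :=
  [/\ I 0, (forall x y, I x -> I y -> I (x - y)) & (forall r x, I x -> I (mul r x))].

Definition complement (V : zmodType) (W U : V -> Prop) : Prop :=
  (forall v, W v -> U v -> v = 0) /\ (forall v, exists w u, [/\ W w, U u & v = w + u]).

Definition semisimple_ring (T : zmodType) (mul : T -> T -> T) : Prop :=
  forall I, left_ideal mul I -> exists J, left_ideal mul J /\ complement I J.

Section Smash.
Variables (k : fieldType) (H : falgType k) (D : hopf_data H) (A : algType k).
Variables (actl : H -> A -> A) (actr : A -> H -> A).

Definition is_bimodule_algebra : Prop :=
      (forall (a : k) x y phi, actl (a *: x + y) phi = a *: actl x phi + actl y phi) /\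
      (forall (a : k) x phi psi, actl x (a *: phi + psi) = a *: actl x phi + actl x psi) /\
      (forall (a : k) x y phi, actr phi (a *: x + y) = a *: actr phi x + actr phi y) /\
      (forall (a : k) x phi psi, actr (a *: phi + psi) x = a *: actr phi x + actr psi x) /\
      (forall x y phi, actl (x * y) phi = actl x (actl y phi)) /\ (forall phi, actl 1 phi = phi) /\
      (forall x y phi, actr phi (x * y) = actr (actr phi x) y) /\ (forall phi, actr phi 1 = phi) /\
      (forall x y phi, actr (actl x phi) y = actl x (actr phi y)) /\
      (forall h phi psi, actl h (phi * psi) = sw D h (fun x y => actl x phi * actl y psi)) /\
      (forall h phi psi, actr (phi * psi) h = sw D h (fun x y => actr phi x * actr psi y)) /\
      (forall h, actl h 1 = heps D h *: 1) /\ (forall h, actr 1 h = heps D h *: 1).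

(* A (x) H, written in the basis of H: x = \sum_i x i # hb i *)
Definition smash := {ffun 'I_(hdim H) -> A}.

Definition sm (phi : A) (h : H) : smash := [ffun l => hcoord l h *: phi].

Definition smul_pure (phi : A) (h : H) (psi : A) (h' : H) : smash :=
  sw D h (fun x1 x2 => sw D h' (fun y1 y2 => sm (actr phi y2 * actl x1 psi) (x2 * y1))).

Definition smul (x y : smash) : smash :=
  \sum_(p < hdim H) \sum_(q < hdim H) smul_pure (x p) (hb p) (y q) (hb q).

Definition sone : smash := sm 1 1.

Definition smash_module (V : zmodType) (act : smash -> V -> V) : Prop :=
  [/\ (forall x y v, act (x + y) v = act x v + act y v),
      (forall x v w, act x (v + w) = act x v + act x w),
      (forall x y v, act (smul x y) v = act x (act y v)) &
      (forall v, act sone v = v)].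

Definition smash_submodule (V : zmodType) (act : smash -> V -> V) (W : V -> Prop) :=
  [/\ W 0, (forall v w, W v -> W w -> W (v - w)) & (forall x v, W v -> W (act x v))].

Definition A_submodule (V : zmodType) (act : smash -> V -> V) (W : V -> Prop) :=
  [/\ W 0, (forall v w, W v -> W w -> W (v - w)) & (forall (phi : A) v, W v -> W (act (sm phi 1) v))].

End Smash.

(* Main.v *)
Require Import Defs.
From HB Require Import structures.
From mathcomp Require Import all_boot all_order all_algebra all_field.
From Stdlib Require Import IndefiniteDescription.
Set Implicit Arguments. Unset Strict Implicit. Unset Printing Implicit Defensive.
Import Order.TTheory GRing.Theory Num.Theory.
Local Open Scope ring_scope.

(* Semisimplicity of [H] gives a two-sided integral [t] with [eps t = 1]. The
   form [l h = Tr (x |-> h S^2 x)] is a left integral of [H^*] with [l t = 1],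
   and it is two-sided by unimodularity. Comparing the four contractions of
   [Delta t] against [l] shows that [S] is bijective and that
   [t_2 (x) t_1 = S^2 t_1 (x) t_2].

   In the smash product [phi # h = (phi . S^-1 h_2) h_1], so that
   [h phi = (h_1 . phi . S^-1 h_3) h_2]. Given an [A]-linear projection [p]
   onto [W], the average [P v = S t_1 p (t_2 v)] is [H]-linear, and moving
   [phi] through it produces [(phi . S^-1 t_4 t_1) S t_2 p (t_3 v)]; the twist
   identity turns [S^-1 t_4 t_1] into [S t_1 t_2], which cancels. Hence
   [ker P] is a complement of [W].

   For (ii), the relation above shows that the smash product is generated by
   [1 # H] as a left [A]-module, hence finitely generated over a semisimple
   ring, so that every left ideal has an [A]-complement and (i) applies. *)

(** * Linear maps and Sweedler sums *)

Section LinearMaps.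
Variable k : fieldType.

(** Linearity is a predicate here because the Hopf structure maps, the actions and the Sweedler
    summands are all bare functions. *)
Definition lin (U X : lmodType k) (f : U -> X) : Prop :=
  forall a x y, f (a *: x + y) = a *: f x + f y.

Section Basic.
Variables (U X : lmodType k) (f : U -> X).
Hypothesis lf : lin f.

Lemma linE0 : f 0 = 0.
Proof.
have /eqP := lf 1 0 0.
by rewrite !scale1r addr0 -subr_eq0 opprD addNKr oppr_eq0 => /eqP.
Qed.

Lemma linEZ a x : f (a *: x) = a *: f x.
Proof. by rewrite -[a *: x]addr0 lf linE0 addr0. Qed.

Lemma linED x y : f (x + y) = f x + f y.
Proof. by rewrite -[x]scale1r lf !scale1r. Qed.

Lemma linEB x y : f (x - y) = f x - f y.
Proof. by rewrite linED -scaleN1r linEZ scaleN1r. Qed.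

Lemma linE_sum (I : Type) (r : seq I) (P : pred I) (F : I -> U) :
  f (\sum_(i <- r | P i) F i) = \sum_(i <- r | P i) f (F i).
Proof. exact: (big_morph f linED linE0). Qed.

End Basic.

Lemma lin_id (X : lmodType k) : lin (fun x : X => x).
Proof. by []. Qed.

Lemma lin_comp (U X Y : lmodType k) (g : X -> Y) (f : U -> X) :
  lin g -> lin f -> lin (fun x => g (f x)).
Proof. by move=> lg lf a x y; rewrite lf lg. Qed.

Lemma lin_scale (U X : lmodType k) (c : k) (f : U -> X) :
  lin f -> lin (fun x => c *: f x).
Proof. by move=> lf a x y; rewrite lf scalerDr !scalerA mulrC. Qed.

Lemma lin_scalel (U X : lmodType k) (v : X) (g : U -> k^o) :
  lin g -> lin (fun x => (g x : k) *: v).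
Proof. by move=> lg a x y; rewrite lg scalerDl scalerA. Qed.

Lemma lin_sum (U X : lmodType k) (I : Type) (r : seq I) (F : I -> U -> X) :
  (forall i, lin (F i)) -> lin (fun x => \sum_(i <- r) F i x).
Proof.
move=> lF a x y; rewrite scaler_sumr -big_split /=.
by apply: eq_bigr => i _; rewrite lF.
Qed.

Lemma lin_mull (U : lmodType k) (B : algType k) (c : B) (f : U -> B) :
  lin f -> lin (fun x => f x * c).
Proof. by move=> lf a x y; rewrite lf mulrDl scalerAl. Qed.

Lemma lin_mulr (U : lmodType k) (B : algType k) (c : B) (f : U -> B) :
  lin f -> lin (fun x => c * f x).
Proof. by move=> lf a x y; rewrite lf mulrDr scalerAr. Qed.

End LinearMaps.

Section Sweedler.
Variables (k : fieldType) (H : falgType k) (D : hopf_data H).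
Hypothesis hopfD : is_hopf D.

Local Notation n := (hdim H).
Local Notation eps := (heps D).
Local Notation S := (hS D).
Local Notation sw := (sw D).

Lemma hcoord_lin (i : 'I_n) : lin (hcoord i : H -> k^o).
Proof. by move=> a x y; rewrite /hcoord linearP. Qed.

Lemma hb_decomp (x : H) : x = \sum_(i < n) hcoord i x *: hb i.
Proof.
rewrite {1}(coord_vbasis (memvf x)); apply: eq_bigr => i _.
by rewrite /hb (tnth_nth 0).
Qed.

Lemma hcoord_hb (i j : 'I_n) : hcoord i (hb j) = (i == j)%:R.
Proof.
have F := basis_free (vbasisP (fullv : {vspace H})).
by rewrite /hcoord /hb (tnth_nth 0) (coord_free j i F) eq_sym.
Qed.

Lemma lin_hb (X : lmodType k) (f : H -> X) x :
  lin f -> f x = \sum_(i < n) hcoord i x *: f (hb i).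
Proof.
move=> lf; rewrite {1}(hb_decomp x) (linE_sum lf).
by apply: eq_bigr => i _; rewrite (linEZ lf).
Qed.

Lemma eq_sw (X : lmodType k) h (F G : H -> H -> X) :
  (forall x y, F x y = G x y) -> sw h F = sw h G.
Proof.
by move=> FG; apply: eq_bigr => i _; apply: eq_bigr => j _; rewrite FG.
Qed.

Lemma sw_swap (X : lmodType k) g h (F : H -> H -> H -> H -> X) :
  sw g (fun a b => sw h (fun c d => F a b c d))
  = sw h (fun c d => sw g (fun a b => F a b c d)).
Proof.
rewrite /Defs.sw; under eq_bigr => i _ do under eq_bigr => j _ do
  (rewrite scaler_sumr; under eq_bigr => p _ do rewrite scaler_sumr).
under [RHS]eq_bigr => i _ do under eq_bigr => j _ do
  (rewrite scaler_sumr; under eq_bigr => p _ do rewrite scaler_sumr).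
rewrite pair_bigA [RHS]pair_bigA /=.
under eq_bigr => i _ do rewrite pair_bigA /=.
under [RHS]eq_bigr => i _ do rewrite pair_bigA /=.
rewrite exchange_big /=; apply: eq_bigr => p _; apply: eq_bigr => q _.
by rewrite !scalerA mulrC.
Qed.

Lemma sw_out (X Y : lmodType k) (f : X -> Y) h (F : H -> H -> X) :
  lin f -> f (sw h F) = sw h (fun a b => f (F a b)).
Proof.
move=> lf; rewrite /Defs.sw (linE_sum lf); apply: eq_bigr => i _.
rewrite (linE_sum lf); apply: eq_bigr => j _; exact: linEZ.
Qed.

Lemma sw_scale (X : lmodType k) (c : k) h (F : H -> H -> X) :
  sw h (fun a b => c *: F a b) = c *: sw h F.
Proof. by rewrite (sw_out (f := fun x => c *: x)) //; exact/lin_scale/lin_id. Qed.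

Lemma lin_sw (U X : lmodType k) h (F : U -> H -> H -> X) :
  (forall a b, lin (fun x => F x a b)) -> lin (fun x => sw h (F x)).
Proof.
move=> lF; apply: lin_sum => i; apply: lin_sum => j.
by apply: lin_scale; apply: lF.
Qed.

Lemma sw_sum (X : lmodType k) (I : Type) (r : seq I) h (F : I -> H -> H -> X) :
  sw h (fun a b => \sum_(i <- r) F i a b) = \sum_(i <- r) sw h (F i).
Proof.
rewrite /Defs.sw; under eq_bigr => i _ do (under eq_bigr => j _ do rewrite scaler_sumr;
  rewrite exchange_big /=).
by rewrite exchange_big.
Qed.

Lemma sw_mull (B : algType k) (c : B) h (F : H -> H -> B) :
  sw h F * c = sw h (fun a b => F a b * c).
Proof. by apply: (sw_out (f := fun z : B => z * c)); apply/lin_mull/lin_id. Qed.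

Lemma sw_mulr (B : algType k) (c : B) h (F : H -> H -> B) :
  c * sw h F = sw h (fun a b => c * F a b).
Proof. by apply: (sw_out (f := fun z : B => c * z)); apply/lin_mulr/lin_id. Qed.

Let hdelta_lin : lin (hdelta D).
Proof. by case: hopfD. Qed.

Lemma lin_sw_arg (U X : lmodType k) (f : U -> H) (F : H -> H -> X) :
  lin f -> lin (fun x => sw (f x) F).
Proof.
move=> lf; apply: (lin_comp (g := fun h => sw h F)) lf.
apply: lin_sum => i; apply: lin_sum => j.
apply: (lin_scalel _ (g := fun h => hdelta D h i j)) => a x y.
by rewrite hdelta_lin !mxE.
Qed.

Lemma lin_eps (U X : lmodType k) (v : X) (f : U -> H) :
  lin f -> lin (fun x => eps (f x) *: v).
Proof.
case: hopfD => _ [le _] lf.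
by apply: (lin_scalel _ (g := fun x => eps (f x))) => a x y; rewrite lf le.
Qed.

Lemma lin_S (U : lmodType k) (f : U -> H) : lin f -> lin (fun x => S (f x)).
Proof. by case: hopfD => _ [_ [lS _]]; exact: lin_comp. Qed.

(** The universal property of [H (x) H] in coordinates: a bilinear [F] factors through [tens2]. *)
Lemma bilin_tens2 (X : lmodType k) (F : H -> H -> X) x y :
  (forall b, lin (fun a => F a b)) -> (forall a, lin (fun b => F a b)) ->
  \sum_(i < n) \sum_(j < n) tens2 x y i j *: F (hb i) (hb j) = F x y.
Proof.
move=> l1 l2; rewrite (lin_hb x (l1 y)); apply: eq_bigr => i _.
rewrite (lin_hb y (l2 _)) scaler_sumr; apply: eq_bigr => j _.
by rewrite mxE scalerA.
Qed.

Lemma sw_coassoc (X : lmodType k) h (F : H -> H -> H -> X) :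
  (forall b c, lin (fun a => F a b c)) -> (forall a c, lin (fun b => F a b c)) ->
  (forall a b, lin (fun c => F a b c)) ->
  sw h (fun x y => sw x (fun a b => F a b y))
  = sw h (fun x y => sw y (fun a b => F x a b)).
Proof.
move=> l1 l2 l3.
(* [ev] is the linear map on coordinate tensors induced by the trilinear [F]; it carries the axiom,
   stated for [tens3], over to [F]. *)
pose ev (T : {ffun 'I_n * 'I_n * 'I_n -> k^o}) :=
  \sum_p (T p : k) *: F (hb p.1.1) (hb p.1.2) (hb p.2).
have lev : lin ev.
  apply: lin_sum => p; apply: (lin_scalel _ (g := fun T : {ffun _ -> k^o} => T p)).
  by move=> a x y; rewrite !ffunE.
have evE x y z : ev (tens3 x y z) = F x y z.
  transitivity (\sum_(p : 'I_n * 'I_n) \sum_(l < n)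
      (tens3 x y z (p, l) : k) *: F (hb p.1) (hb p.2) (hb l)).
    by rewrite pair_bigA; apply: eq_bigr => -[p l].
  rewrite -(bilin_tens2 x y (F := fun x y => F x y z)) // [RHS]pair_bigA /=.
  apply: eq_bigr => p _; rewrite (lin_hb z (l3 _ _)) scaler_sumr.
  by apply: eq_bigr => l _; rewrite ffunE mxE scalerA.
case: hopfD => _ [_ [_ [/(_ h) /(congr1 ev)]]].
rewrite !(sw_out _ _ lev).
under eq_sw => x y do [rewrite (sw_out _ _ lev); under eq_sw => a b do rewrite evE].
by under [X in _ = X -> _]eq_sw => x y do
  [rewrite (sw_out _ _ lev); under eq_sw => a b do rewrite evE].
Qed.

Lemma sw_counitl (X : lmodType k) h (F : H -> X) :
  lin F -> sw h (fun x y => eps x *: F y) = F h.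
Proof.
case: hopfD => _ [_ [_ [_ [/(_ h)[e _] _]]]] lF.
by rewrite -{2}e (sw_out _ _ lF); apply: eq_sw => x y; rewrite (linEZ lF).
Qed.

Lemma sw_counitr (X : lmodType k) h (F : H -> X) :
  lin F -> sw h (fun x y => eps y *: F x) = F h.
Proof.
case: hopfD => _ [_ [_ [_ [/(_ h)[_ e] _]]]] lF.
by rewrite -{2}e (sw_out _ _ lF); apply: eq_sw => x y; rewrite (linEZ lF).
Qed.

Lemma sw_mul (X : lmodType k) g h (F : H -> H -> X) :
  (forall b, lin (fun a => F a b)) -> (forall a, lin (fun b => F a b)) ->
  sw (g * h) F = sw g (fun a b => sw h (fun c d => F (a * c) (b * d))).
Proof.
move=> l1 l2.
pose ev (T : 'M[k]_n) := \sum_(i < n) \sum_(j < n) T i j *: F (hb i) (hb j).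
have lev : lin ev.
  apply: lin_sum => i; apply: lin_sum => j.
  by apply: (lin_scalel _ (g := fun T : 'M[k]_n => T i j)) => a x y; rewrite !mxE.
rewrite -[LHS]/(ev _); case: hopfD => _ [_ [_ [_ [_ [[-> _] _]]]]].
rewrite (sw_out _ _ lev); apply: eq_sw => a b.
by rewrite (sw_out _ _ lev); apply: eq_sw => c d; apply: bilin_tens2.
Qed.

Lemma sw1 (X : lmodType k) (F : H -> H -> X) :
  (forall b, lin (fun a => F a b)) -> (forall a, lin (fun b => F a b)) ->
  sw 1 F = F 1 1.
Proof.
move=> l1 l2; case: hopfD => _ [_ [_ [_ [_ [[_ d1] _]]]]].
by rewrite /Defs.sw d1; apply: bilin_tens2.
Qed.

Lemma epsM x y : eps (x * y) = eps x * eps y.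
Proof. by case: hopfD => _ [_ [_ [_ [_ [_ [[]]]]]]]. Qed.

Lemma eps1 : eps 1 = 1.
Proof. by case: hopfD => _ [_ [_ [_ [_ [_ [[]]]]]]]. Qed.

Lemma sw_antipl (X : lmodType k) h (F : H -> X) :
  lin F -> sw h (fun x y => F (S x * y)) = eps h *: F 1.
Proof.
case: hopfD => _ [_ [_ [_ [_ [_ [_ /(_ h) [e _]]]]]]] lF.
by rewrite -(sw_out _ _ lF) e (linEZ lF).
Qed.

Lemma sw_antipr (X : lmodType k) h (F : H -> X) :
  lin F -> sw h (fun x y => F (x * S y)) = eps h *: F 1.
Proof.
case: hopfD => _ [_ [_ [_ [_ [_ [_ /(_ h) [_ e]]]]]]] lF.
by rewrite -(sw_out _ _ lF) e (linEZ lF).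
Qed.

End Sweedler.
Arguments sw_out {k H D X Y} f h F.
Arguments sw_coassoc {k H D} hopfD {X} h F.
Arguments sw_counitl {k H D} hopfD {X} h F.
Arguments sw_counitr {k H D} hopfD {X} h F.
Arguments sw_mul {k H D} hopfD {X} g h F.
Arguments sw_antipl {k H D} hopfD {X} h F.
Arguments sw_antipr {k H D} hopfD {X} h F.
Arguments sw1 {k H D} hopfD {X} F.

(** Peels the outermost map off a linear expression; linearity facts in the context serve as further
    rules. *)
Ltac lin_step := cbv beta; match goal with
  | |- forall a, lin (@?f a) => intro
  | |- forall a b, lin (@?f a b) => do 2 intro
  | |- forall a b c, lin (@?f a b c) => do 3 intro
  | |- lin _ => first
    [ assumption | apply: lin_id | apply: lin_eps; [assumption|]
    | apply: lin_scale | apply: lin_scalel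
    | apply: lin_S; [assumption|]
    | apply: lin_mull | apply: lin_mulr
    | apply: lin_sw_arg; [assumption|] | apply: lin_sw
    | match goal with l : lin _ |- _ => apply: (lin_comp l) end
    | match goal with l : forall a, lin (@?f a) |- _ => apply: (lin_comp (l _)) end
    | match goal with l : forall a b, lin (@?f a b) |- _ => apply: (lin_comp (l _ _)) end
    | match goal with l : forall a b c, lin (@?f a b c) |- _ =>
        apply: (lin_comp (l _ _ _)) end ]
  end.
Ltac lin := repeat lin_step.

(** * The antipode *)

Section Antipode.
Variables (k : fieldType) (H : falgType k) (D : hopf_data H).
Hypothesis hopfD : is_hopf D.
Local Notation eps := (heps D).
Local Notation S := (hS D).
Local Notation sw := (sw D).

Lemma antip1 : S 1 = 1.
Proof.
have := sw_antipl hopfD 1 _ (@lin_id k H).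
by rewrite (sw1 hopfD); lin; rewrite mulr1 (eps1 hopfD) scale1r.
Qed.

Section Cancel.
Variables (X : lmodType k) (F : H -> H -> X).
Hypothesis lF1 : forall b, lin (fun a => F a b).
Hypothesis lF2 : forall a, lin (fun b => F a b).

(** The legs [h_1] and [h_2] are not grouped yet, so coassociativity comes before the antipode law;
    the counit then absorbs the scalar. *)
Lemma sw_cancel_Sl h :
  sw h (fun a y => sw y (fun b c => F (S a * b) c)) = F 1 h.
Proof.
rewrite -(sw_coassoc hopfD h (fun a b c => F (S a * b) c)); lin.
under eq_sw => x y do rewrite (sw_antipl hopfD _ _ (lF1 y)).
by rewrite (sw_counitl hopfD); lin.
Qed.

Lemma sw_cancel_Sr h :
  sw h (fun a y => sw y (fun b c => F (a * S b) c)) = F 1 h.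
Proof.
rewrite -(sw_coassoc hopfD h (fun a b c => F (a * S b) c)); lin.
under eq_sw => x y do rewrite (sw_antipr hopfD _ _ (lF1 y)).
by rewrite (sw_counitl hopfD); lin.
Qed.

Lemma sw_cancel_rS h :
  sw h (fun a y => sw y (fun b c => F a (b * S c))) = F h 1.
Proof.
under eq_sw => x y do rewrite (sw_antipr hopfD _ _ (lF2 x)).
by rewrite (sw_counitr hopfD); lin.
Qed.

End Cancel.
Arguments sw_cancel_Sl {X} F.
Arguments sw_cancel_Sr {X} F.
Arguments sw_cancel_rS {X} F.

(* Both sides equal [S y_1 S x_1 x_2 y_2 S (x_3 y_3)]. *)
Lemma antipM x y : S (x * y) = S y * S x.
Proof.
pose m := sw y (fun y1 y2 => sw x (fun x1 x2 => S y1 * (S x1 *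
  sw x2 (fun a b => sw y2 (fun c d => (a * c) * S (b * d)))))).
transitivity m; rewrite {}/m.
  under [RHS]eq_sw => y1 y2 do (under eq_sw => x1 x2 do (
     rewrite !sw_mulr; under eq_sw => a b do (rewrite !sw_mulr;
      under eq_sw => c d do rewrite !mulrA -(mulrA (S y1)));
     cbv beta);
     rewrite (sw_cancel_Sl (fun z b : H => sw y2 (fun c d => S y1 * z * c * S (b * d)))); lin;
     under eq_sw => c d do rewrite mulr1).
  by rewrite (sw_cancel_Sl (fun z b : H => z * S (x * b))); lin; rewrite mul1r.
under eq_sw => y1 y2 do (under eq_sw => x1 x2 do (
    rewrite -(sw_mul hopfD x2 y2 (fun a b => a * S b)); lin;
    rewrite (sw_antipr hopfD _ _ (lin_id (X := H))) (epsM hopfD) mulrC;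
    rewrite -scalerA -!scalerAr mulr1);
    rewrite sw_scale (sw_counitr hopfD _ (fun z => S y1 * S z)); lin).
by rewrite (sw_counitr hopfD _ (fun z => S z * S x)); lin.
Qed.

(* Both sides equal [F (S(h_1)_1 h_2 S h_5) (S(h_1)_2 h_3 S h_4)]. *)
Lemma sw_antip (X : lmodType k) h (F : H -> H -> X) :
  (forall b, lin (fun a => F a b)) -> (forall a, lin (fun b => F a b)) ->
  sw (S h) F = sw h (fun x y => F (S y) (S x)).
Proof.
move=> l1 l2.
transitivity (sw h (fun x y => sw y (fun b w => sw (S x * b) (fun p q =>
  sw w (fun d e => F (p * S e) (q * S d)))))); last first.
  rewrite (sw_cancel_Sl (fun z w => sw z (fun p q =>
    sw w (fun d e => F (p * S e) (q * S d))))); lin.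
  rewrite (sw1 hopfD); lin; apply: eq_sw => a b; by rewrite !mul1r.
transitivity (sw h (fun x y => eps y *: sw (S x) F)).
  by rewrite (sw_counitr hopfD _ (fun x => sw (S x) F)); lin.
apply: eq_sw => x y; rewrite -sw_scale.
under [RHS]eq_sw => b w do (rewrite (sw_mul hopfD); lin).
rewrite sw_swap; apply: eq_sw => p q.
rewrite (sw_coassoc hopfD y (fun b1 b2 w =>
  sw w (fun d e => F (p * b1 * S e) (q * b2 * S d)))); lin.
transitivity (sw y (fun b e => F (p * (b * S e)) q)).
  by rewrite (sw_antipr hopfD _ (fun z => F (p * z) q)); lin; rewrite mulr1.
apply: eq_sw => b e.
under eq_sw => c w do under eq_sw => d f do rewrite -(mulrA q).
by rewrite (sw_cancel_Sr (fun z f : H => F (p * b * S f) (q * z))); lin; rewrite mulr1 mulrA.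
Qed.

(** Apply the multiplicative [eps] to [S h_1 h_2 = eps h]. *)
Lemma eps_antip h : eps (S h) = eps h.
Proof.
suff /eqP : eps (S h) *: (1 : H) = eps h *: 1.
  by rewrite -subr_eq0 -scalerBl scaler_eq0 oner_eq0 orbF subr_eq0 => /eqP.
transitivity (sw h (fun a b => eps (S a * b) *: (1 : H))).
  under eq_sw => a b do rewrite (epsM hopfD) mulrC -scalerA.
  by rewrite (sw_counitr hopfD _ (fun a => eps (S a) *: 1)); lin.
by rewrite (sw_antipl hopfD _ (fun z => eps z *: 1)); lin; rewrite (eps1 hopfD) scale1r.
Qed.

End Antipode.
Arguments sw_cancel_Sl {k H D} hopfD {X} F.
Arguments sw_cancel_Sr {k H D} hopfD {X} F.
Arguments sw_cancel_rS {k H D} hopfD {X} F.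

(** * Integrals *)

Section Integrals.
Variables (k : fieldType) (H : falgType k) (D : hopf_data H).
Hypothesis hopfD : is_hopf D.
Local Notation n := (hdim H).
Local Notation eps := (heps D).
Local Notation S := (hS D).
Local Notation sw := (sw D).

Lemma semisimple_integral : semisimple_ring (@GRing.mul H) ->
  exists t, [/\ eps t = 1, (forall h, h * t = eps h *: t) &
                (forall h, t * h = eps h *: t)].
Proof.
move=> ssH.
have le : lin (eps : H -> k^o) by case: hopfD => _ [].
(* [J] complements the augmentation ideal; the component of [1] in [J] will be the integral. *)
have [|J [[J0 JB JM] [KJ0 KJ1]]] := ssH (fun x => eps x = 0).
  split; first exact: (linE0 le).
  - by move=> x y ex ey; rewrite (linEB le) ex ey subr0.
  - by move=> r x ex; rewrite (epsM hopfD) ex mulr0.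
have [e [t [ee Jt e1]]] := KJ1 1.
have et : eps t = 1 by rewrite -(eps1 hopfD) e1 (linED le) ee add0r.
(* The difference of the two sides lies both in the kernel of [eps] and in [J]. *)
have lt h : h * t = eps h *: t.
  apply/eqP; rewrite -subr_eq0; apply/eqP; apply: KJ0.
    by rewrite (linEB le) (linEZ le) (epsM hopfD) subrr.
  by apply: JB; [apply: JM | rewrite -[t]mul1r scalerAl; apply: JM].
exists t; split=> // h.
(* A left integral killed by [eps] squares to zero, and so does the left ideal it spans. *)
have nil s : (forall g, g * s = eps g *: s) -> eps s = 0 -> s = 0.
  move=> ls es.
  have [|K [[K0 KB KM] [sK0 sK1]]] := ssH (fun x => exists a, x = a *: s).
    split; first by exists 0; rewrite scale0r.
    - by move=> x y [a ->] [b ->]; exists (a - b); rewrite scalerBl.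
    - by move=> r x [a ->]; exists (a * eps r); rewrite -scalerAr ls scalerA.
  have [w [u [[a ->] Ku e2]]] := sK1 1.
  apply: sK0; first by exists 1; rewrite scale1r.
  (* Since [s * s = 0], multiplying [1 = a *: s + u] by [s] gives [s = s * u], which lies in [K]. *)
  by rewrite -[s]mulr1 e2 mulrDr -scalerAr ls es scale0r scaler0 add0r; apply: KM.
(* The defect [t * h - eps h *: t] is itself a left integral killed by [eps]. *)
apply/eqP; rewrite -subr_eq0; apply/eqP; apply: nil => [g|].
  by rewrite mulrBr mulrA lt -scalerAl -scalerAr lt scalerBr !scalerA mulrC.
by rewrite (linEB le) (linEZ le) (epsM hopfD) (mulrC (eps t)) subrr.
Qed.

Definition trace_form (h : H) : k := \sum_(i < n) hcoord i (h * S (S (hb i))).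

Lemma trace_form_lin : lin (trace_form : H -> k^o).
Proof.
apply: lin_sum => i; have l := @hcoord_lin k H i; lin.
Qed.

(** An instance of the cyclicity of the trace. By [key], the trace over [hb i] turns into a sum over
    [hb l] of the terms [g_1 S g_2 (x) g_3] with [g = h S^2 (hb l)], the third leg being read by
    [hcoord l]; the first two legs cancel and leave the trace again. *)
Lemma trace_form_left h :
  sw h (fun x y => trace_form y *: x) = trace_form h *: 1.
Proof.
have lc := @hcoord_lin k H.
(* [h_1 (x) h_2 S^2 x = (h S^2 x_2)_1 S x_1 (x) (h S^2 x_2)_2] *)
have key x (f : H -> k) : lin (f : H -> k^o) ->
    sw h (fun p q => f (q * S (S x)) *: p)
  = sw x (fun a b => sw (h * S (S b)) (fun p q => f q *: (p * S a))).
  move=> lf; apply/esym.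
  under eq_sw => a b do (rewrite (sw_mul hopfD); lin).
  rewrite sw_swap; apply: eq_sw => p q.
  under eq_sw => a b do (do 2!(rewrite (sw_antip hopfD); lin);
    under eq_sw => b1 b2 do rewrite -mulrA -(antipM hopfD)).
  rewrite (sw_cancel_Sr hopfD (fun z b : H => f (q * S (S b)) *: (p * S z))); lin.
  by rewrite (antip1 hopfD) mulr1.
rewrite {1}/trace_form; under eq_sw => x y do rewrite scaler_suml.
rewrite sw_sum; under eq_bigr => i _ do (rewrite (key (hb i) (hcoord i) (lc i));
  under eq_sw => a b do (rewrite (lin_hb b (f := fun b => sw (h * S (S b))
    (fun p q => hcoord i q *: (p * S a)))); lin;
    under eq_bigr => l _ do rewrite -sw_scale);
  rewrite sw_sum; under eq_bigr => l _ do rewrite sw_swap).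
rewrite exchange_big scaler_suml /=; apply: eq_bigr => l _.
rewrite -sw_sum -(sw_cancel_Sr hopfD (fun z b => hcoord l b *: z)); lin.
apply: eq_sw => p q.
rewrite (lin_hb q (f := fun q => sw q (fun a b => hcoord l b *: (p * S a)))); lin.
apply: eq_bigr => i _; rewrite -sw_scale; apply: eq_sw => a b.
by rewrite !scalerA mulrC.
Qed.

Lemma trace_form_left_integral : left_integral_dual D trace_form.
Proof.
split=> [|f lf h]; first exact: trace_form_lin.
have /(congr1 f) := trace_form_left h.
rewrite (sw_out (f : H -> k^o)) // => E.
transitivity (f (trace_form h *: 1)); last first.
  by rewrite (linEZ (lf : lin (f : H -> k^o))) mulrC.
rewrite -E; apply: eq_sw => x y.
by rewrite (linEZ (lf : lin (f : H -> k^o))) mulrC.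
Qed.

(** As [t S^2 x = eps x *: t], the map being traced has rank one and trace [eps t]. *)
Lemma trace_form_integral t :
  eps t = 1 -> (forall h, t * h = eps h *: t) -> trace_form t = 1.
Proof.
move=> et rt; have le : lin (eps : H -> k^o) by case: hopfD => _ [].
rewrite -[RHS]et [t in RHS]hb_decomp (linE_sum le); apply: eq_bigr => i _.
rewrite rt !(eps_antip hopfD) (linEZ (@hcoord_lin k H i)) (linEZ le).
by rewrite -[LHS]/(_ * _) mulrC.
Qed.

Lemma lform_separate (u v : H) :
  (forall f : H -> k, lin (f : H -> k^o) -> f u = f v) -> u = v.
Proof.
move=> uv; rewrite (hb_decomp u) (hb_decomp v).
by apply: eq_bigr => i _; rewrite (uv _ (@hcoord_lin k H i)).
Qed.

(** Linear forms separate the points of [H], so the condition tested on every [f] becomes an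
    identity in [H]. *)
Lemma right_integral_dualE (l : H -> k) h : right_integral_dual D l ->
  sw h (fun x y => l x *: y) = l h *: 1.
Proof.
case=> ll il; apply: lform_separate => f lf.
transitivity (f 1 * l h); last by rewrite (linEZ lf) mulrC.
rewrite -(il _ lf h) (sw_out _ _ _ lf).
by apply: (@eq_sw k H D k^o) => x y; rewrite (linEZ lf).
Qed.

Lemma left_integral_dualE (l : H -> k) h : left_integral_dual D l ->
  sw h (fun x y => l y *: x) = l h *: 1.
Proof.
case=> ll il; apply: lform_separate => f lf.
transitivity (f 1 * l h); last by rewrite (linEZ lf) mulrC.
rewrite -(il _ lf h) (sw_out _ _ _ lf).
by apply: (@eq_sw k H D k^o) => x y; rewrite (linEZ lf) mulrC.
Qed.

End Integrals.

(** * The twist identity for integrals *)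

Section Twist.
Variables (k : fieldType) (H : falgType k) (D : hopf_data H).
Hypothesis hopfD : is_hopf D.
Local Notation eps := (heps D).
Local Notation S := (hS D).
Local Notation sw := (sw D).

Variables (l : H -> k) (t : H).
Hypothesis l_lin : lin (l : H -> k^o).
Hypothesis l_left : forall h, sw h (fun x y => l y *: x) = l h *: 1.
Hypothesis l_right : forall h, sw h (fun x y => l x *: y) = l h *: 1.
Hypothesis lt1 : l t = 1.
Hypothesis t_left : forall h, h * t = eps h *: t.
Hypothesis t_right : forall h, t * h = eps h *: t.

Let lZ a x : l (a *: x) = a * l x.
Proof. exact: (linEZ l_lin). Qed.

(** Insert [S x_1 x_2] in front of [y_1]: in [l (x_3 y_2) S x_1 x_2 y_1] the legs form the coproduct
    of [x_2 y], which the left integral contracts. *)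
Lemma left_integral_shift x y :
  sw x (fun a b => l (b * y) *: S a) = sw y (fun c d => l (x * d) *: c).
Proof.
transitivity (sw y (fun c d => l (x * d) *: (1 * c))); last first.
  by apply: eq_sw => c d; rewrite mul1r.
rewrite -(sw_cancel_Sl hopfD (fun z w => sw y (fun c d => l (w * d) *: (z * c)))); lin.
apply: eq_sw => a x'.
under eq_sw => b w do under eq_sw => c d do rewrite -mulrA scalerAr.
under eq_sw => b w do rewrite -sw_mulr.
rewrite -sw_mulr -(sw_mul hopfD _ _ (fun p q => l q *: p)); lin.
by rewrite l_left -scalerAr mulr1.
Qed.

(** The mirror argument: [y_2 S y_3] is inserted behind [x_2], and the right integral contracts the
    coproduct of [x y_1]. *)
Lemma right_integral_shift x y :
  sw x (fun a b => l (a * y) *: b) = sw y (fun c d => l (x * c) *: S d).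
Proof.
transitivity (sw x (fun a b => l (a * y) *: (b * 1))).
  by apply: eq_sw => a b; rewrite mulr1.
rewrite -(sw_cancel_rS hopfD (fun u v => sw x (fun a b => l (a * u) *: (b * v)))); lin.
rewrite -(sw_coassoc hopfD _ (fun u v w => sw x (fun a b => l (a * u) *: (b * (v * S w))))); lin.
apply: eq_sw => z w; rewrite sw_swap.
under eq_sw => b a do under eq_sw => c d do rewrite mulrA scalerAl.
under eq_sw => b a do rewrite -sw_mull.
rewrite -sw_mull -(sw_mul hopfD _ _ (fun p q => l p *: q)); lin.
by rewrite l_right -scalerAl mul1r.
Qed.

(** The shift moves the coproduct from [t] to [y], where [t y_2 = eps y_2 t] and [l t = 1]. In
    particular [S] is onto. *)
Lemma integral_decomp y : sw t (fun a b => l (b * y) *: S a) = y.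
Proof.
rewrite left_integral_shift.
under eq_sw => c d do rewrite t_right lZ lt1 mulr1.
by rewrite (sw_counitr hopfD _ (fun c => c)); lin.
Qed.

Lemma integral_antip_contractr x : sw t (fun a b => l (x * b) *: a) = S x.
Proof.
rewrite -left_integral_shift.
under eq_sw => c d do rewrite t_left lZ lt1 mulr1.
by rewrite (sw_counitr hopfD); lin.
Qed.

Lemma integral_antip_contractl y : sw t (fun a b => l (a * y) *: b) = S y.
Proof.
rewrite right_integral_shift.
under eq_sw => c d do rewrite t_right lZ lt1 mulr1.
by rewrite (sw_counitl hopfD); lin.
Qed.

(** Both sides equal [l (x t_2) l (t_1 y)], by the two contraction formulas for [S]. *)
Lemma integral_antip_move x y : l (S x * y) = l (x * S y).
Proof.
rewrite -integral_antip_contractr -integral_antip_contractl sw_mulr sw_mull !(sw_out _ _ _ l_lin).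
by apply: (@eq_sw k H D k^o) => a b; rewrite -scalerAl -scalerAr !lZ mulrC.
Qed.

(** The expansion of [integral_decomp] with its [S] stripped off, which makes it a right inverse of
    [S]. *)
Definition antip_inv y := sw t (fun a b => l (b * y) *: a).

Lemma antip_invK y : S (antip_inv y) = y.
Proof.
rewrite (sw_out S); lin.
rewrite -[RHS]integral_decomp; apply: eq_sw => a b.
by rewrite (linEZ (lin_S hopfD (lin_id (X := H)))).
Qed.

Lemma antip_inv_lin : lin antip_inv.
Proof. rewrite /antip_inv; lin. Qed.

(** Injectivity of [S]: if [S z = 0], then [l (S y' * z) = l (y' * S z) = 0]. As [S] is onto, all
    values [l (y * z)] vanish, and [integral_decomp] rebuilds [z] from them. *)
Lemma antipK x : antip_inv (S x) = x.
Proof.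
have lS : lin S by apply: (lin_S hopfD (lin_id (X := H))).
apply/eqP; rewrite -subr_eq0; set z := _ - x.
have Sz : S z = 0 by rewrite (linEB lS) antip_invK subrr.
have lz y : l (y * z) = 0.
  by rewrite -[y]antip_invK integral_antip_move Sz mulr0 (linE0 l_lin).
rewrite -[z]integral_decomp; apply/eqP.
rewrite /Defs.sw !big1 // => i _; rewrite big1 // => j _.
by rewrite lz scale0r scaler0.
Qed.

(** Both sides equal [F (S t_2) (antip_inv t_1)]: the second argument is expanded by [dec] over a
    second copy of [t], and the first copy is then contracted away. *)
Lemma integral_twist (X : lmodType k) (F : H -> H -> X) :
  (forall b, lin (fun a => F a b)) -> (forall a, lin (fun b => F a b)) ->
  sw t (fun a b => F (S (S a)) b) = sw t (fun a b => F b a).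
Proof.
move=> l1 l2; have lI := antip_inv_lin.
have lS : lin S by apply: (lin_S hopfD (lin_id (X := H))).
have dec b : sw t (fun c d => l (b * d) *: antip_inv c) = b.
  rewrite -[RHS]antipK -integral_antip_contractr (sw_out _ _ _ lI).
  by apply: eq_sw => c d; rewrite (linEZ lI).
transitivity (sw t (fun c d => F (S d) (antip_inv c))).
  under eq_sw => a b do (rewrite -{1}(dec b) (sw_out (F _)); lin;
    under eq_sw => c d do (rewrite (linEZ (l2 _)))).
  rewrite sw_swap; apply: eq_sw => c d.
  rewrite -[d in S d]integral_decomp (sw_out _ _ _ lS) (sw_out (F^~ _)); lin.
  by apply: eq_sw => a b; rewrite (linEZ lS) (linEZ (l1 _)).
under [RHS]eq_sw => a b do (rewrite -{1}(dec a) (sw_out (F _)); lin;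
    under eq_sw => c d do (rewrite (linEZ (l2 _)))).
rewrite [RHS]sw_swap; apply: eq_sw => c d.
rewrite -integral_antip_contractl (sw_out (F^~ _)); lin.
by apply: eq_sw => a b; rewrite (linEZ (l1 _)).
Qed.

End Twist.

Lemma unimodular_integral (k : fieldType) (H : falgType k) (D : hopf_data H) :
  is_hopf D -> semisimple_ring (@GRing.mul H) -> dual_unimodular D ->
  exists (t : H) (Sinv : H -> H),
    [/\ heps D t = 1, (forall h, t * h = heps D h *: t), lin Sinv,
        cancel (hS D) Sinv /\ cancel Sinv (hS D) &
        forall (X : lmodType k) (F : H -> H -> X),
          (forall b, lin (fun a => F a b)) -> (forall a, lin (fun b => F a b)) ->
          sw D t (fun a b => F (hS D (hS D a)) b) = sw D t (fun a b => F b a)].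
Proof.
move=> hD ss uni; have [t [et tl tr]] := semisimple_integral hD ss.
pose l := trace_form D; have lL := trace_form_left_integral hD.
(* Unimodularity enters here and makes the trace form a two-sided integral. *)
have lR : right_integral_dual D l by apply/uni.
have hl := fun h => left_integral_dualE h lL.
have hr := fun h => right_integral_dualE h lR.
have l1 : l t = 1 by apply: trace_form_integral.
have ll : lin (l : H -> k^o) by exact: trace_form_lin.
exists t, (antip_inv D l t); split=> //; first exact: antip_inv_lin.
  by split; [apply: antipK | apply: antip_invK].
by move=> X F; apply: integral_twist.
Qed.

(** * The smash product algebra *)

Section SmashAlgebra.
Variables (k : fieldType) (H : falgType k) (D : hopf_data H) (A : algType k).
Variables (actl : H -> A -> A) (actr : A -> H -> A).
Hypothesis hopfD : is_hopf D.
Hypothesis bimA : is_bimodule_algebra D actl actr.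
Local Notation eps := (heps D).
Local Notation S := (hS D).
Local Notation sw := (sw D).
Local Notation smul := (smul D actl actr).
Local Notation smul_pure := (smul_pure D actl actr).

Lemma actl_linl phi : lin (fun h => actl h phi).
Proof. by case: bimA => l _ a x y; apply: l. Qed.
Lemma actl_linr h : lin (fun phi => actl h phi).
Proof. by case: bimA => _ [l _] a x y; apply: l. Qed.
Lemma actr_linr phi : lin (fun h => actr phi h).
Proof. by case: bimA => _ [_ [l _]] a x y; apply: l. Qed.
Lemma actr_linl h : lin (fun phi => actr phi h).
Proof. by case: bimA => _ [_ [_ [l _]]] a x y; apply: l. Qed.
Lemma actlM x y phi : actl (x * y) phi = actl x (actl y phi).
Proof. by case: bimA => _ [_ [_ [_ []]]]. Qed.
Lemma actl1 phi : actl 1 phi = phi.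
Proof. by case: bimA => _ [_ [_ [_ [_ []]]]]. Qed.
Lemma actrM x y phi : actr phi (x * y) = actr (actr phi x) y.
Proof. by case: bimA => _ [_ [_ [_ [_ [_ []]]]]]. Qed.
Lemma actr1 phi : actr phi 1 = phi.
Proof. by case: bimA => _ [_ [_ [_ [_ [_ [_ []]]]]]]. Qed.
Lemma actlr x y phi : actr (actl x phi) y = actl x (actr phi y).
Proof. by case: bimA => _ [_ [_ [_ [_ [_ [_ [_ []]]]]]]]. Qed.
Lemma actl_mul h phi psi :
  actl h (phi * psi) = sw h (fun x y => actl x phi * actl y psi).
Proof. by case: bimA => _ [_ [_ [_ [_ [_ [_ [_ [_ []]]]]]]]]. Qed.
Lemma actr_mul h phi psi :
  actr (phi * psi) h = sw h (fun x y => actr phi x * actr psi y).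
Proof. by case: bimA => _ [_ [_ [_ [_ [_ [_ [_ [_ [_ []]]]]]]]]]. Qed.
Lemma actl_unit h : actl h 1 = eps h *: 1.
Proof. by case: bimA => _ [_ [_ [_ [_ [_ [_ [_ [_ [_ [_ []]]]]]]]]]]. Qed.
Lemma actr_unit h : actr 1 h = eps h *: 1.
Proof. by case: bimA => _ [_ [_ [_ [_ [_ [_ [_ [_ [_ [_ []]]]]]]]]]]. Qed.

Lemma sm_linl (h : H) : lin (fun phi : A => sm phi h : {ffun _ -> A}).
Proof. by move=> a x y; apply/ffunP => i; rewrite !ffunE scalerDr !scalerA mulrC. Qed.

Lemma sm_linr (phi : A) : lin (fun h : H => sm phi h : {ffun _ -> A}).
Proof.
move=> a x y; apply/ffunP => i; rewrite !ffunE.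
by rewrite (@hcoord_lin k H i) scalerDl scalerA.
Qed.

(** Linearity of the actions and of [sm] in each variable, recalled for use by [lin]. *)
Let l1 := actl_linl. Let l2 := actl_linr. Let l3 := actr_linl. Let l4 := actr_linr.
Let l5 := sm_linl. Let l6 := sm_linr.

Lemma sm_decomp (x : smash H A) : x = \sum_(p < hdim H) sm (x p) (hb p).
Proof.
apply/ffunP => i; rewrite sum_ffunE (bigD1 i) //= big1 => [|j ji].
  by rewrite ffunE hcoord_hb eqxx scale1r addr0.
by rewrite ffunE hcoord_hb eq_sym (negPf ji) scale0r.
Qed.

Lemma smul_pure_lin1 h psi g : lin (fun phi => smul_pure phi h psi g).
Proof. rewrite /Defs.smul_pure; lin. Qed.
Lemma smul_pure_lin2 phi psi g : lin (fun h => smul_pure phi h psi g).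
Proof. rewrite /Defs.smul_pure; lin. Qed.
Lemma smul_pure_lin3 phi h g : lin (fun psi => smul_pure phi h psi g).
Proof. rewrite /Defs.smul_pure; lin. Qed.
Lemma smul_pure_lin4 phi h psi : lin (fun g => smul_pure phi h psi g).
Proof. rewrite /Defs.smul_pure; lin. Qed.
Let p1 := smul_pure_lin1. Let p2 := smul_pure_lin2.
Let p3 := smul_pure_lin3. Let p4 := smul_pure_lin4.

Let appl_lin (p : 'I_(hdim H)) : lin (fun x : {ffun 'I_(hdim H) -> A} => x p).
Proof. by move=> a x y; rewrite !ffunE. Qed.

Lemma smul_linl y : lin (fun x : {ffun 'I_(hdim H) -> A} => smul x y).
Proof.
apply: lin_sum => p; apply: lin_sum => q.
by apply: (lin_comp (smul_pure_lin1 _ _ _)).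
Qed.

Lemma smul_linr x : lin (fun y : {ffun 'I_(hdim H) -> A} => smul x y).
Proof.
apply: lin_sum => p; apply: lin_sum => q.
by apply: (lin_comp (smul_pure_lin3 _ _ _)).
Qed.

Lemma smul_sm phi h psi g : smul (sm phi h) (sm psi g) = smul_pure phi h psi g.
Proof.
rewrite (lin_hb h (p2 _ _ _)); apply: eq_bigr => i _.
rewrite (lin_hb g (p4 _ _ _)) scaler_sumr; apply: eq_bigr => j _.
by rewrite !ffunE (linEZ (p1 _ _ _)) (linEZ (p3 _ _ _)).
Qed.

(** Both bracketings reduce to [(phi . g_3 f_2)(h_1 . psi . f_3)(h_2 g_1 . chi) # h_3 g_2 f_1]; the
    bimodule law makes the middle factor unambiguous. *)
Lemma smulA_sm phi h psi g chi f :
  smul (smul (sm phi h) (sm psi g)) (sm chi f)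
  = smul (sm phi h) (smul (sm psi g) (sm chi f)).
Proof.
have s1 := smul_linl; have s2 := smul_linr.
rewrite !smul_sm.
transitivity (sw h (fun h1 h' => sw h' (fun h2 h3 => sw g (fun a g' =>
  sw g' (fun b g2 => sw f (fun f1 f' => sw f' (fun c d =>
   sm (actr phi (g2 * c) * actr (actl h1 psi) d * actl (h2 * a) chi)
     (h3 * b * f1) : {ffun _ -> A})))))));
  last apply/esym.
- rewrite (sw_out (smul^~ (sm chi f))); lin; apply: eq_sw => h1 h'.
  rewrite (sw_out (smul^~ (sm chi f))); lin.
  under eq_sw => g1 g2 do (rewrite smul_sm /Defs.smul_pure (sw_mul hopfD); lin).
  rewrite sw_swap; apply: eq_sw => h2 h3.
  rewrite -(sw_coassoc hopfD g (fun a b g2 => sw f (fun f1 f' => sw f' (fun c d =>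
   sm (actr phi (g2 * c) * actr (actl h1 psi) d * actl (h2 * a) chi)
     (h3 * b * f1) : {ffun _ -> A})))); lin.
  apply: eq_sw => g1 g2; apply: eq_sw => a b; apply: eq_sw => f1 f'.
  rewrite actr_mul sw_mull (sw_out (fun z => sm z _)); lin.
  by apply: eq_sw => c d; rewrite actrM.
- rewrite (sw_out (smul (sm phi h))); lin.
  under eq_sw => g1 g' do (rewrite (sw_out (smul (sm phi h))); lin;
    under eq_sw => f1 f2 do rewrite smul_sm /Defs.smul_pure; rewrite sw_swap).
  rewrite sw_swap -(sw_coassoc hopfD h (fun h1 h2 h3 => sw g (fun a g' =>
  sw g' (fun b g2 => sw f (fun f1 f' => sw f' (fun c d =>
   sm (actr phi (g2 * c) * actr (actl h1 psi) d * actl (h2 * a) chi)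
     (h3 * b * f1) : {ffun _ -> A})))))); lin.
  apply: eq_sw => h' h3.
  rewrite [RHS]sw_swap; apply: eq_sw => a g'.
  under eq_sw => f' d do (rewrite (sw_mul hopfD); lin).
  rewrite sw_swap [RHS]sw_swap; apply: eq_sw => b g2.
  rewrite (sw_coassoc hopfD f (fun f1 c d =>
    sm (actr phi (g2 * c) * actl h' (actr psi d * actl a chi)) (h3 * (b * f1)) : {ffun _ -> A})); lin.
  rewrite [RHS]sw_swap; apply: eq_sw => f1 f'.
  rewrite [RHS]sw_swap; apply: eq_sw => c d.
  rewrite actl_mul sw_mulr (sw_out (fun z => sm z _)); lin.
  by apply: eq_sw => x y; rewrite actlr actlM !mulrA.
Qed.

Lemma smash_ext (X : lmodType k) (f g : {ffun 'I_(hdim H) -> A} -> X) :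
  lin f -> lin g -> (forall phi h, f (sm phi h) = g (sm phi h)) -> f =1 g.
Proof.
move=> lf lg fg x; rewrite [x]sm_decomp (linE_sum lf) (linE_sum lg).
by apply: eq_bigr => i _; apply: fg.
Qed.

Lemma smulA x y z : smul (smul x y) z = smul x (smul y z).
Proof.
have s1 := smul_linl; have s2 := smul_linr.
apply: (smash_ext (f := fun x => smul (smul x y) z) (g := fun x => smul x (smul y z))) x.
- exact: (lin_comp (s1 z) (s1 y)).
- exact: s1.
move=> phi h.
apply: (smash_ext (f := fun y => smul (smul _ y) z) (g := fun y => smul _ (smul y z))) y.
- exact: (lin_comp (s1 z) (s2 _)).
- exact: (lin_comp (s2 _) (s1 z)).
move=> psi g.
apply: (smash_ext (f := fun z => smul (smul _ _) z) (g := fun z => smul _ (smul _ z))) z.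
- exact: s2.
- exact: (lin_comp (s2 _) (s2 _)).
by move=> chi f; apply: smulA_sm.
Qed.

(** Left multiplication by [phi # 1] twists [phi] by the leg [g_2]; [act_smE] undoes this twist with
    the inverse antipode. *)
Lemma smul_1l phi psi g :
  smul (sm phi 1) (sm psi g) = sw g (fun x y => sm (actr phi y * psi) x).
Proof.
rewrite smul_sm /Defs.smul_pure (sw1 hopfD); lin.
by apply: eq_sw => x y; rewrite actl1 mul1r.
Qed.

Lemma smul_1r phi h psi :
  smul (sm phi h) (sm psi 1) = sw h (fun x y => sm (phi * actl x psi) y).
Proof.
rewrite smul_sm /Defs.smul_pure; apply: eq_sw => x y; rewrite (sw1 hopfD); lin.
by rewrite actr1 mulr1.
Qed.

Lemma smul_11 h g : smul (sm 1 h) (sm 1 g) = sm 1 (h * g).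
Proof.
rewrite smul_sm /Defs.smul_pure.
transitivity (sw h (fun x1 x2 => eps x1 *: (sm 1 (x2 * g) : {ffun _ -> A}))); last first.
  by rewrite (sw_counitl hopfD _ (fun x => sm 1 (x * g) : {ffun _ -> A})); lin.
apply: eq_sw => x1 x2.
under eq_sw => y1 y2 do rewrite actr_unit actl_unit -scalerAl -scalerAr mul1r
  (linEZ (l5 _)) (linEZ (l5 _)).
by rewrite (sw_counitr hopfD _ (fun y => eps x1 *: (sm 1 (x2 * y) : {ffun _ -> A}))); lin.
Qed.

Lemma smul_AA phi psi : smul (sm phi 1) (sm psi 1) = sm (phi * psi) 1.
Proof. by rewrite smul_1l (sw1 hopfD); lin; rewrite actr1. Qed.

Lemma smul1s x : smul (sone H A) x = x.
Proof.
apply: (smash_ext (smul_linr _) (lin_id (X := _))) x => phi h.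
rewrite /sone smul_1l.
under eq_sw => a b do rewrite actr_unit -scalerAl mul1r (linEZ (l5 _)).
by rewrite (sw_counitr hopfD _ (fun y => sm phi y : {ffun _ -> A})); lin.
Qed.

Lemma smuls1 x : smul x (sone H A) = x.
Proof.
apply: (smash_ext (smul_linl _) (lin_id (X := _))) x => phi h.
rewrite /sone smul_1r.
under eq_sw => a b do rewrite actl_unit -scalerAr mulr1 (linEZ (l5 _)).
by rewrite (sw_counitl hopfD _ (fun y => sm phi y : {ffun _ -> A})); lin.
Qed.

Lemma smul_scalar (a : k) (x : {ffun 'I_(hdim H) -> A}) : smul (sm a%:A 1) x = a *: x.
Proof. by rewrite (linEZ (l5 1)) (linEZ (smul_linl x)) smul1s. Qed.

End SmashAlgebra.

(** * Averaging *)

Section Maschke.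
Variables (k : fieldType) (H : falgType k) (D : hopf_data H) (A : algType k).
Variables (actl : H -> A -> A) (actr : A -> H -> A).
Hypothesis hopfD : is_hopf D.
Hypothesis bimA : is_bimodule_algebra D actl actr.
Local Notation eps := (heps D).
Local Notation S := (hS D).
Local Notation sw := (sw D).
Local Notation smul := (smul D actl actr).

Variables (V : lmodType k) (act : smash H A -> V -> V).
Hypothesis actV : smash_module D actl actr act.
Hypothesis act_scale : forall a v, act (sm a%:A 1) v = a *: v.

Lemma act_mul x y v : act (smul x y) v = act x (act y v).
Proof. by case: actV. Qed.

Lemma sm_scalar a : sm (a%:A : A) (1 : H) = (a *: (sone H A : {ffun _ -> A})).
Proof. by rewrite (linEZ (@sm_linl k H A 1)). Qed.

(** Scalars act through the central elements [a%:A # 1], so biadditivity of the action gives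
    bilinearity. *)
Lemma act_linl v : lin (fun x : {ffun 'I_(hdim H) -> A} => act x v).
Proof.
move=> a x y; case: actV => -> _ _ _; congr (_ + _).
rewrite -act_scale -act_mul sm_scalar.
by rewrite (linEZ (smul_linl bimA x)) (smul1s hopfD bimA).
Qed.

Lemma act_linr x : lin (act x).
Proof.
move=> a v w; case: actV => _ -> _ _; congr (_ + _).
rewrite -[a *: v]act_scale -act_mul sm_scalar.
rewrite (linEZ (smul_linr bimA x)) (smuls1 hopfD bimA).
by rewrite (linEZ (act_linl v)).
Qed.

Variables (t : H) (Sinv : H -> H).
Hypothesis eps_t : eps t = 1.
Hypothesis t_right : forall h, t * h = eps h *: t.
Hypothesis Sinv_lin : lin Sinv.
Hypothesis SK : cancel S Sinv.
Hypothesis SinvK : cancel Sinv S.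
Hypothesis t_twist : forall (X : lmodType k) (F : H -> H -> X),
  (forall b, lin (fun a => F a b)) -> (forall a, lin (fun b => F a b)) ->
  sw t (fun a b => F (S (S a)) b) = sw t (fun a b => F b a).

Let l1 := actl_linl bimA. Let l2 := actl_linr bimA.
Let l3 := actr_linl bimA. Let l4 := actr_linr bimA.
Let l5 := @sm_linl k H A. Let l6 := @sm_linr k H A.
Let l7 := act_linl. Let l8 := act_linr.

(** Apply [Sinv] to [S h_1 h_2 = eps h]; being anti-multiplicative, it reverses the two factors. *)
Lemma sw_antip_inv (X : lmodType k) h (F : H -> X) :
  lin F -> sw h (fun x y => F (Sinv y * x)) = eps h *: F 1.
Proof.
move=> lF; have E x y : Sinv y * x = Sinv (S x * y).
  by rewrite -[LHS]SK (antipM hopfD) SinvK.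
under eq_sw => x y do rewrite E.
rewrite (sw_antipl hopfD _ (fun z => F (Sinv z))); lin.
by rewrite -{1}(antip1 hopfD) SK.
Qed.

Local Notation iA phi v := (act (sm phi 1) v).
Local Notation iH h v := (act (sm 1 h) v).

(** By [smul_1l] the right side is the action of [phi . (Sinv h_3 h_2) # h_1], where the inverse
    antipode cancels. *)
Lemma act_smE phi h v :
  act (sm phi h) v = sw h (fun x y => iA (actr phi (Sinv y)) (iH x v)).
Proof.
apply/esym.
under eq_sw => x y do (rewrite -act_mul (smul_1l hopfD bimA) (sw_out (act^~ v)); lin;
  under eq_sw => a b do rewrite mulr1 -(actrM bimA)).
rewrite (sw_coassoc hopfD h (fun a b y => act (sm (actr phi (Sinv y * b)) a) v)); lin.
under eq_sw => x y do
  (rewrite (sw_antip_inv _ (F := fun z => act (sm (actr phi z) x) v)); lin; rewrite (actr1 bimA)).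
by rewrite (sw_counitr hopfD _ (fun x => act (sm phi x) v)); lin.
Qed.

Lemma actHA h psi v :
  iH h (iA psi v) = sw h (fun x y => act (sm (actl x psi) y) v).
Proof.
rewrite -act_mul (smul_1r hopfD bimA) (sw_out (act^~ v)); lin.
by apply: eq_sw => x y; rewrite mul1r.
Qed.

Lemma actHH h g v : iH h (iH g v) = iH (h * g) v.
Proof. by rewrite -act_mul (smul_11 hopfD bimA). Qed.

Lemma act1 v : iH 1 v = v.
Proof. by case: actV. Qed.

Variable p : V -> V.
Hypothesis p_add : forall v w, p (v + w) = p v + p w.
Hypothesis pA : forall phi v, p (iA phi v) = iA phi (p v).

Lemma p_lin : lin p.
Proof. by move=> a v w; rewrite p_add -act_scale pA act_scale. Qed.

Let lp := p_lin.

Definition average v := sw t (fun a b => iH (S a) (p (iH b v))).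

Lemma average_lin : lin average.
Proof. rewrite /average; lin. Qed.

(** As [t] is a right integral, [h (x) t] may be replaced by [h_1 (x) t h_2]. This gives
    [h_1 S h_2 S t_1 p (t_2 h_3 v)], in which [h_1 S h_2] cancels. *)
Lemma averageH h v : average (iH h v) = iH h (average v).
Proof.
rewrite [RHS](sw_out (act (sm 1 h))); lin.
under [RHS]eq_sw => a b do rewrite actHH.
transitivity (sw h (fun x y => sw (t * y) (fun a b => iH (x * S a) (p (iH b v))))); last first.
  under eq_sw => x y do rewrite t_right (linEZ (lin_sw_arg hopfD
    (fun a b => iH (x * S a) (p (iH b v))) (lin_id (X := H)))).
  by rewrite (sw_counitr hopfD _ (fun x => sw t (fun a b => iH (x * S a) (p (iH b v))))); lin.
under [RHS]eq_sw => x y do (rewrite (sw_mul hopfD); lin).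
rewrite [RHS]sw_swap; apply: eq_sw => a b.
under [RHS]eq_sw => x y do under eq_sw => c d do rewrite (antipM hopfD) mulrA.
rewrite (sw_cancel_Sr hopfD (fun z d => iH (z * S a) (p (iH (b * d) v)))); lin.
by rewrite mul1r actHH.
Qed.

(** The rule [h psi = (h_1 . psi . Sinv h_3) h_2] at [h = S a]: the legs reverse, and [Sinv (S a_1)]
    is simply [a_1]. *)
Lemma antip_actA a psi w :
  iH (S a) (iA psi w) = sw a (fun x d => sw x (fun b c =>
    iA (actr (actl (S d) psi) b) (iH (S c) w))).
Proof.
rewrite actHA (sw_antip hopfD); lin.
apply: eq_sw => x y; rewrite act_smE (sw_antip hopfD); lin.
by apply: eq_sw => b c; rewrite SK.
Qed.

Lemma p_actHA b phi v :
  p (iH b (iA phi v)) = sw b (fun x z => sw z (fun c d =>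
    iA (actr (actl x phi) (Sinv d)) (p (iH c v)))).
Proof.
rewrite actHA (sw_out p); lin; apply: eq_sw => x z.
by rewrite act_smE (sw_out p); lin; apply: eq_sw => c d; rewrite pA.
Qed.

Lemma averageA phi v : average (iA phi v) = iA phi (average v).
Proof.
(* With six legs of [t] the left side is [(S t_3 t_4 . phi . Sinv t_6 t_1) S t_2 p (t_5 v)]. In [R],
   [x] splits into [t_1, t_2], [z] into [t_5, t_6], and [u] is [S t_3 t_4]. *)
pose R x z u := sw z (fun c d => sw x (fun b q =>
  iA (actr (actl u phi) (Sinv d * b)) (iH (S q) (p (iH c v))))).
transitivity (sw t (fun a b => sw a (fun x y => sw b (fun u z => R x z (S y * u))))).
  apply: eq_sw => a b; rewrite p_actHA (sw_out (act (sm 1 (S a)))); lin.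
  rewrite [RHS]sw_swap; apply: eq_sw => u z.
  rewrite (sw_out (act (sm 1 (S a)))); lin.
  rewrite /R [RHS]sw_swap; apply: eq_sw => c d.
  rewrite antip_actA; apply: eq_sw => x y; apply: eq_sw => e q.
  by rewrite (actlM bimA) (actrM bimA) !(actlr bimA).
(* Regrouping lets [S t_3 t_4] cancel, which removes the left action on [phi]. *)
rewrite (sw_coassoc hopfD t (fun x y b => sw b (fun u z => R x z (S y * u)))); rewrite {}/R; lin.
under eq_sw => x b do (rewrite (sw_cancel_Sl hopfD (fun u z => sw z (fun c d => sw x (fun b q =>
  iA (actr (actl u phi) (Sinv d * b)) (iH (S q) (p (iH c v))))))); lin;
  rewrite (actl1 bimA)).
(* The last leg, now [t_4], is isolated so that the twist identity brings it to the front as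
   [S^2 t_1]; then [Sinv] turns it into [S t_1], next to [t_2]. *)
rewrite -(sw_coassoc hopfD t (fun x c d => sw x (fun b q =>
  iA (actr phi (Sinv d * b)) (iH (S q) (p (iH c v)))))); lin.
rewrite -(t_twist (F := fun d y => sw y (fun x c => sw x (fun b q =>
  iA (actr phi (Sinv d * b)) (iH (S q) (p (iH c v))))))); lin.
under eq_sw => a y do (rewrite SK;
  rewrite (sw_coassoc hopfD y (fun b q c =>
    iA (actr phi (S a * b)) (iH (S q) (p (iH c v))))); lin).
rewrite (sw_cancel_Sl hopfD (fun u z => sw z (fun q c =>
  iA (actr phi u) (iH (S q) (p (iH c v)))))); lin.
by rewrite (actr1 bimA) [RHS](sw_out (act (sm phi 1))); lin.
Qed.

Lemma average_act x v : average (act x v) = act x (average v).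
Proof.
have la := average_lin.
apply: (smash_ext (f := fun x => average (act x v)) (g := fun x => act x (average v))) x; lin.
move=> phi h; rewrite !act_smE (sw_out average); lin.
by apply: eq_sw => x y; rewrite averageA averageH.
Qed.

(** Once [p] drops out, the average is [S t_1 t_2 v = eps t *: v]. *)
Lemma average_id v : (forall x, p (act x v) = act x v) -> average v = v.
Proof.
move=> pv; rewrite /average.
under eq_sw => a b do rewrite pv actHH.
by rewrite (sw_antipl hopfD _ (fun z => iH z v)); lin; rewrite eps_t scale1r act1.
Qed.

End Maschke.

(** * Complements *)

Definition add_subgroup (V : zmodType) (W : V -> Prop) : Prop :=
  W 0 /\ forall v w, W v -> W w -> W (v - w).

Lemma add_subgroupD (V : zmodType) (W : V -> Prop) :
  add_subgroup W -> forall v w, W v -> W w -> W (v + w).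
Proof.
move=> [W0 WB] v w Wv Ww; rewrite -[w]opprK; apply: (WB) => //.
by rewrite -[- w]sub0r; apply: WB.
Qed.

Lemma complement_uniq (V : zmodType) (W U : V -> Prop) :
  add_subgroup W -> add_subgroup U -> complement W U ->
  forall w w' u u', W w -> W w' -> U u -> U u' -> w + u = w' + u' -> w = w'.
Proof.
move=> [W0 WB] [U0 UB] [WU0 _] w w' u u' Ww Ww' Uu Uu' e.
apply/eqP; rewrite -subr_eq0; apply/eqP; apply: WU0; first exact: WB.
have -> : w - w' = u' - u.
  by apply/eqP; rewrite subr_eq addrAC -(addrC w') -e addrK.
exact: UB.
Qed.

Lemma complement_projection (V : zmodType) (W U : V -> Prop) :
  add_subgroup W -> add_subgroup U -> complement W U ->
  exists p : V -> V, [/\ forall v, W (p v), forall v, U (v - p v),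
    forall v, W v -> p v = v & forall v w, p (v + w) = p v + p w].
Proof.
move=> sW sU cWU; have WU_uniq := complement_uniq sW sU cWU.
(* Components are only known to exist, so choice selects one for each [v]; their uniqueness makes
   the selection additive. *)
have [|p pP] := @functional_choice V V (fun v w => W w /\ U (v - w)).
  move=> v; case: cWU => _ /(_ v) [w [u [Ww Uu ->]]]; exists w.
  by rewrite addrC addKr.
have Wp v : W (p v) by case: (pP v).
have Up v : U (v - p v) by case: (pP v).
exists p; split=> // [v Wv|v w].
  by apply: (WU_uniq _ _ (v - p v) 0) => //; [case: sU | rewrite addr0 addrC subrK].
apply: (WU_uniq _ _ (v + w - p (v + w)) ((v - p v) + (w - p w))) => //.
- exact: add_subgroupD.
- exact: add_subgroupD.
by rewrite [RHS]addrACA !(addrC (p _)) !subrK.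
Qed.

(** * Complements over finitely many generators of a module over a semisimple ring *)

Section FinitelyGenerated.
Variables (A : nzRingType) (V : zmodType) (act : A -> V -> V).
Hypothesis actDl : forall a b v, act (a + b) v = act a v + act b v.
Hypothesis actDr : forall a v w, act a (v + w) = act a v + act a w.
Hypothesis actM : forall a b v, act (a * b) v = act a (act b v).
Hypothesis act1 : forall v, act 1 v = v.
Hypothesis ssA : semisimple_ring (@GRing.mul A).

Definition submodule (W : V -> Prop) : Prop :=
  add_subgroup W /\ forall a v, W v -> W (act a v).

Definition sum_space (W U : V -> Prop) (v : V) : Prop :=
  exists w u, [/\ W w, U u & v = w + u].

Lemma sum_space_submodule W U :
  submodule W -> submodule U -> submodule (sum_space W U).
Proof.
move=> [[W0 WB] WM] [[U0 UB] UM]; split; first split.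
- by exists 0, 0; rewrite addr0.
- move=> _ _ [w [u [Ww Uu ->]]] [w' [u' [Ww' Uu' ->]]].
  by exists (w - w'), (u - u'); split; [apply: WB | apply: UB | rewrite opprD addrACA].
- move=> a _ [w [u [Ww Uu ->]]].
  by exists (act a w), (act a u); split; [apply: WM | apply: UM | rewrite actDr].
Qed.

Let act0l v : act 0 v = 0.
Proof. by apply: (addrI (act 0 v)); rewrite -actDl !addr0. Qed.

Let actNl a v : act (- a) v = - act a v.
Proof. by apply: (addrI (act a v)); rewrite -actDl !subrr. Qed.

(** Induction on the generators. For a new [g], let [J] complement the left ideal of all [a] with
    [a g] in [W + U], and replace [U] by [U + J g]. If [u + a g] lies in [W] with [a] in [J], then
    [a] is also in that ideal, so [a = 0]; splitting [1] along the ideal and [J] puts [g] into the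
    new sum. *)
Lemma semisimple_complement_fg (s : seq V) (W : V -> Prop) : submodule W ->
  exists U, [/\ submodule U, forall v, W v -> U v -> v = 0 &
                forall v, v \in s -> sum_space W U v].
Proof.
move=> sW; elim: s => [|g s [U [sU WU0 sU1]]].
  exists (fun v => v = 0); split=> //; split; first split=> //.
    by move=> _ _ -> ->; rewrite subr0.
  move=> a _ ->; by apply: (addrI (act a 0)); rewrite -actDr !addr0.
have [[Z0 ZB] ZM] := sum_space_submodule sW sU.
have [|J [[J0 JB JM] [IJ0 IJ1]]] := ssA (I := fun a => sum_space W U (act a g)).
  split=> [|a b|a b]; first by rewrite act0l.
    by rewrite actDl actNl; apply: ZB.
  by rewrite actM; apply: ZM.
pose Jg v := exists2 a, J a & v = act a g.
have sJg : submodule Jg.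
  split; first split.
  - by exists 0; rewrite ?act0l.
  - move=> _ _ [a Ja ->] [b Jb ->]; exists (a - b); first exact: JB.
    by rewrite actDl actNl.
  - by move=> a _ [b Jb ->]; exists (a * b); [apply: JM | rewrite actM].
have [sW0 WM] := sW; have [sU0 UM] := sU.
exists (sum_space U Jg); split; first exact: sum_space_submodule.
- move=> v Wv [u [_ [Uu [a Ja ->] e]]].
  have a0 : a = 0.
    apply: IJ0 => //; exists v, (- u); split=> //.
      by case: sU0 => U0 UB; rewrite -sub0r; apply: UB.
    by rewrite e addrC addKr.
  by move: e; rewrite a0 act0l addr0 => e; apply: WU0; rewrite // e.
- move=> v; rewrite inE => /predU1P [-> | /sU1 [w [u [Ww Uu ->]]]].
    have [a [b [[w [u [Ww Uu e]]] Jb e1]]] := IJ1 1.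
    exists w, (u + act b g); split=> //; first by exists u, (act b g); split=> //; exists b.
    by rewrite -[LHS]act1 e1 actDl e addrA.
  exists w, u; split=> //; exists u, 0; split=> //; last by rewrite addr0.
  by exists 0; rewrite ?act0l.
Qed.

End FinitelyGenerated.

(** * Maschke's theorem and semisimplicity of the smash product *)

Section Semisimplicity.
Variables (k : fieldType) (H : falgType k) (D : hopf_data H) (A : algType k).
Variables (actl : H -> A -> A) (actr : A -> H -> A).
Hypothesis hopfD : is_hopf D.
Hypothesis ssH : semisimple_ring (@GRing.mul H).
Hypothesis uniD : dual_unimodular D.
Hypothesis bimA : is_bimodule_algebra D actl actr.
Local Notation smul := (smul D actl actr).

Lemma maschke_lmod (V : lmodType k) (act : smash H A -> V -> V) (W : V -> Prop) :
  smash_module D actl actr act -> (forall a v, act (sm a%:A 1) v = a *: v) ->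
  smash_submodule act W ->
  (exists U : V -> Prop, A_submodule act U /\ complement W U) ->
  exists U : V -> Prop, smash_submodule act U /\ complement W U.
Proof.
move=> actV actZ [W0 WB WM] [U [[U0 UB UM] cWU]].
have sW : add_subgroup W by [].
have sU : add_subgroup U by [].
have WU_uniq := complement_uniq sW sU cWU.
have [p [Wp Up pW pD]] := complement_projection sW sU cWU.
have [_ actD _ _] := actV.
(* Both [W] and [U] are stable under [A], so the two decompositions of [phi v] must agree. *)
have pA phi v : p (act (sm phi 1) v) = act (sm phi 1) (p v).
  apply: (WU_uniq _ _ (act (sm phi 1) v - p (act (sm phi 1) v))
    (act (sm phi 1) (v - p v))) => //.
  - exact: WM.
  - exact: UM.
  by rewrite -actD !(addrC (p _)) !subrK.
have [t [Sinv [et tr lSi [SK SiK] tw]]] := unimodular_integral hopfD ssH uniD.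
pose P := average D act t p.
have Pl : lin P := average_lin hopfD bimA actV actZ t pD pA.
have PM x v : P (act x v) = act x (P v).
  exact: (average_act hopfD bimA actV actZ tr lSi SK SiK tw pD pA).
have PW v : W v -> P v = v.
  move=> Wv; apply: (average_id hopfD bimA actV actZ et) => x.
  by rewrite pW //; apply: WM.
have WP v : W (P v).
  have WD := add_subgroupD sW.
  rewrite /P /average /Defs.sw.
  apply: (big_ind W) => // i _; apply: (big_ind W) => // j _.
  by rewrite -actZ; do 2!apply: (WM).
exists (fun v => P v = 0); split; first split.
- exact: (linE0 Pl).
- by move=> v w Pv Pw; rewrite (linEB Pl) Pv Pw subr0.
- by move=> x v Pv; rewrite PM Pv (linE0 (act_linr hopfD bimA actV actZ x)).
split=> [v Wv <-|v]; first by rewrite PW.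
exists (P v), (v - P v); split; first exact: WP.
  by rewrite (linEB Pl) (PW (P v)) ?subrr.
by rewrite addrC subrK.
Qed.

Lemma maschke (V : zmodType) (act : smash H A -> V -> V) (W : V -> Prop) :
  smash_module D actl actr act -> smash_submodule act W ->
  (exists U : V -> Prop, A_submodule act U /\ complement W U) ->
  exists U : V -> Prop, smash_submodule act U /\ complement W U.
Proof.
(* A variable zmodType is not convertible to the constructor form that [HB.pack] unifies with. *)
case: V act W => T cT act W; set V := GRing.Zmodule.Pack cT in act W *.
move=> actV; have [aDl aDr aM a1] := actV.
(* [V] comes without scalars; the action of [a%:A # 1] supplies them, and [maschke_lmod] then
   applies. *)
pose sc (a : k) v := act (sm a%:A 1) v.
have scA a b v : sc a (sc b v) = sc (a * b) v.
  by rewrite /sc -aM (smul_AA hopfD bimA) -scalerAl mul1r scalerA.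
have sc1 : left_id 1 sc by move=> v; rewrite /sc scale1r.
have scDr : right_distributive sc +%R by move=> a v w; rewrite /sc aDr.
have scDl v : {morph sc^~ v : a b / a + b}.
  move=> a b; rewrite /sc scalerDl -aDl; congr (act _ v).
  exact: (linED (@sm_linl k H A 1)).
pose scaling := GRing.Zmodule_isLmodule.Build k V scA sc1 scDr scDl.
pose V' : lmodType k := HB.pack (GRing.Zmodule.sort V) scaling.
exact: (@maschke_lmod V' act W actV).
Qed.

Lemma smash_semisimple : semisimple_ring (@GRing.mul A) -> semisimple_ring smul.
Proof.
move=> ssA I [I0 IB IM].
pose V : lmodType k := {ffun 'I_(hdim H) -> A}.
have actV : smash_module D actl actr (V := V) smul.
  split.
  - by move=> x y v; apply: (linED (smul_linl bimA v)).
  - by move=> x v w; apply: (linED (smul_linr bimA x)).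
  - exact: smulA.
  - exact: smul1s.
have actZ a (v : V) : smul (sm a%:A 1) v = a *: v.
  exact: smul_scalar.
have sI : submodule (fun phi => smul (sm phi 1)) I.
  by split=> // phi v; apply: IM.
(* These elements generate the smash product over [A], as shown below with the inverse antipode. *)
pose s : seq V := [seq sm 1 (hb j) | j : 'I_(hdim H)].
have [||||U [sU IU0 IU1]] := semisimple_complement_fg
  (act := fun phi => smul (sm phi 1)) _ _ _ _ ssA s sI.
- move=> a b v; rewrite -(linED (smul_linl bimA v)); congr (smul _ v).
  exact: (linED (@sm_linl k H A 1)).
- by move=> a v w; apply: (linED (smul_linr bimA _)).
- by move=> a b v; rewrite -(smulA hopfD bimA) (smul_AA hopfD bimA).
- exact: smul1s.
have [||J [[J0 JB JM] cIJ]] := maschke_lmod (V := V) (act := smul) (W := I) actV actZ.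
- by split.
- have Zs : submodule (fun phi => smul (sm phi 1)) (sum_space I U).
    apply: sum_space_submodule sI sU => a v w; exact: (linED (smul_linr bimA _)).
  have [[Z0 _] ZM] := Zs; have ZD := add_subgroupD Zs.1.
  have ZZ a (v : V) : sum_space I U v -> sum_space I U (a *: v).
    by rewrite -actZ; apply: ZM.
  have Z1 h : sum_space I U (sm 1 h).
    rewrite (lin_hb h (f := fun h => sm 1 h : V)); last exact: sm_linr.
    apply: (big_ind (sum_space I U)) => // j _; apply: ZZ; apply: IU1.
    exact: codom_f.
  have [t [Sinv [_ _ lSi [SK SiK] _]]] := unimodular_integral hopfD ssH uniD.
  have Zsm phi h : sum_space I U (sm phi h).
    (* Acting on the unit, [act_smE] writes [phi # h] as a sum of [A]-multiples of elements
       [1 # h_1], all of which [Z1] covers. *)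
    rewrite -[sm phi h](smuls1 hopfD bimA) (act_smE hopfD bimA actV actZ lSi SK SiK).
    rewrite /Defs.sw; apply: (big_ind (sum_space I U)) => // i _.
    apply: (big_ind (sum_space I U)) => // j _; apply: ZZ; apply: ZM.
    by rewrite (smuls1 hopfD bimA).
  exists U; split; first by case: sU => [[U0 UB] UM].
  split=> // v; rewrite [v]sm_decomp.
  exact: (big_ind (sum_space I U)).
by exists J.
Qed.

End Semisimplicity.

Theorem theorem3p2 (k : fieldType) (H : falgType k) (D : hopf_data H)
  (A : algType k) (actl : H -> A -> A) (actr : A -> H -> A) :
  is_hopf D ->
  semisimple_ring (@GRing.mul H) ->
  dual_unimodular D ->
  is_bimodule_algebra D actl actr ->
  (forall (V : zmodType) (act : smash H A -> V -> V) (W : V -> Prop),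
      smash_module D actl actr act ->
      smash_submodule act W ->
      (exists U : V -> Prop, A_submodule act U /\ complement W U) ->
      exists U : V -> Prop, smash_submodule act U /\ complement W U)
  /\
  (semisimple_ring (@GRing.mul A) -> semisimple_ring (smul D actl actr)).
Proof.
move=> hopfD ssH uniD bimA; split; first exact: maschke.
exact: smash_semisimple.
Qed.
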